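(* Let $(P,\preceq)$ be an infinite, locally finite lattice, let $f:P\to\mathbb{R}$, and let $x_1,\dots,x_n$ be distinct elements of $P$ such that $x_i\preceq x_j$ implies $i\le j$. Put $S_n=\{x_1,\dots,x_n\}$ and suppose $S_n$ is join closed. Then the join matrix $[S_n]_f$ is positive definite if and only if $\Phi_{S_n,f}(x_i)>0$ for all $i=1,2,\dots,n$.
   Context: $\vee$ denotes the join in $P$ and $x\prec y$ means $x\preceq y$, $x\neq y$. $S_n$ is join closed if $x_i\vee x_j\in S_n$ for all $x_i,x_j\in S_n$. The join matrix $[S_n]_f$ is the $n\times n$ real symmetric matrix whose $(i,j)$ entry is $f(x_i\vee x_j)$. For a finite subset $B\subseteq P$, the function $\Phi_{B,f}:B\to\mathbb{R}$ is defined recursively (from the top) by $\Phi_{B,f}(b)=f(b)-\sum_{e\in B,\ b\prec e}\Phi_{B,f}(e)$; equivalently, $f(b)=\sum_{e\in B,\ b\preceq e}\Phi_{B,f}(e)$ for all $b\in B$. *)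

(* Defs.v *)
From mathcomp Require Import all_boot all_order all_algebra.
From mathcomp Require Import finmap all_classical reals.

Set Implicit Arguments.
Unset Strict Implicit.
Unset Printing Implicit Defensive.

Import Order.TTheory GRing.Theory Num.Theory.
Local Open Scope ring_scope.

Definition locally_finite (d : Order.disp_t) (P : porderType d) : Prop :=
  forall x y : P, finite_set [set z : P | (x <= z <= y)%O]%classic.

Definition fset_join_closed (d : Order.disp_t) (P : latticeType d)
    (S : {fset P}) : Prop :=
  forall x y : P, x \in S -> y \in S -> Order.join x y \in S.

Definition join_matrix (R : realType) (d : Order.disp_t) (P : latticeType d)
    (n : nat) (x : 'I_n -> P) (f : P -> R) : 'M[R]_n :=
  \matrix_(i < n, j < n) f (Order.join (x i) (x j)).

Definition posdefmx (R : realType) (n : nat) (A : 'M[R]_n) : Prop :=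
  A \is symmetricmx /\
  forall v : 'cV[R]_n, v != 0 -> 0 < (v^T *m A *m v) 0 0.

Section Phi.

Context (R : realType) (d : Order.disp_t) (P : porderType d).
Implicit Types (B : {fset P}) (f : P -> R).

(* The recursion descends from the maximal elements of B and is run with      *)
(* fuel; a strict chain in B has at most #|` B| elements, so this fuel        *)
(* suffices and Phi satisfies its defining recursion on B (PhiE below). Only  *)
(* the values of Phi B f at elements of B are meaningful.                     *)
Fixpoint Phi_fuel (k : nat) B f (b : P) : R :=
  if k is k'.+1 then
    f b - \sum_(e <- enum_fset B | (b < e)%O) Phi_fuel k' B f e
  else 0.

Definition Phi B f (b : P) : R := Phi_fuel #|` B| B f b.

Let above B (b : P) : nat := count (fun e => (b < e)%O) (enum_fset B).

Lemma above_lt B (b e : P) : e \in B -> (b < e)%O -> (above B e < above B b)%N.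
Proof.
move=> eB be; rewrite /above.
have pB := perm_to_rem (eB : e \in enum_fset B).
rewrite !(permP pB) /= be ltxx add0n add1n ltnS.
by apply: sub_count => z /=; apply: lt_trans.
Qed.

Lemma above_lt_card B (b : P) : b \in B -> (above B b < #|` B|)%N.
Proof.
move=> bB; rewrite /above.
have pB := perm_to_rem (bB : b \in enum_fset B).
have eB : #|` B| = (size (rem b (enum_fset B))).+1 := perm_size pB.
by rewrite (permP pB) eB /= ltxx add0n ltnS count_size.
Qed.

Lemma Phi_fuel_stable B f (k l : nat) (b : P) :
  (above B b < k)%N -> (above B b < l)%N ->
  Phi_fuel k B f b = Phi_fuel l B f b.
Proof.
elim: k l b => [//|k IHk] [//|l] b /= bk bl.
congr (_ - _); rewrite big_seq_cond [RHS]big_seq_cond.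
apply: eq_bigr => e /andP[eB be].
have lt_eb := above_lt eB be.
by apply: IHk; apply: leq_trans lt_eb _; rewrite -ltnS.
Qed.

Lemma PhiE B f (b : P) : b \in B ->
  Phi B f b = f b - \sum_(e <- enum_fset B | (b < e)%O) Phi B f e.
Proof.
move=> bB; have bk := above_lt_card bB.
rewrite [LHS](@Phi_fuel_stable _ _ _ #|` B|.+1) //; last exact: leqW.
Qed.

End Phi.

(* Main.v *)
Require Import Defs.
From mathcomp Require Import all_boot all_order all_algebra.
From mathcomp Require Import finmap all_classical reals.

Set Implicit Arguments.
Unset Strict Implicit.
Unset Printing Implicit Defensive.

Import Order.TTheory GRing.Theory Num.Theory.
Local Open Scope ring_scope.
Local Open Scope fset_scope.

(** Grouping [f (x i \/ x j) = \sum_(k | x i \/ x j <= x k) Phi (x k)] by [k]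
    gives the congruence [A = L^T D L], where [L k i] is the indicator of
    [x i <= x k] and [D] is the diagonal matrix of the values of [Phi].  The
    ordering of the [x i] makes [L] unitriangular, so [A] is positive definite
    exactly when [D] is. *)

Definition order_mx (R : realType) (d : Order.disp_t) (P : porderType d)
    (n : nat) (x : 'I_n -> P) : 'M[R]_n :=
  \matrix_(k < n, i < n) (x i <= x k)%O%:R.

Lemma order_mx_unit (R : realType) (d : Order.disp_t) (P : porderType d)
    (n : nat) (x : 'I_n -> P) :
  (forall i j : 'I_n, (x i <= x j)%O -> (i <= j)%N) ->
  order_mx R x \in unitmx.
Proof.
move=> hord; rewrite unitmxE det_trig; last first.
  apply/is_trig_mxP => i j ij; rewrite mxE.
  by case: (boolP (x j <= x i)%O) => // /hord; rewrite leqNgt ij.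
by rewrite big1 ?unitr1 // => i _; rewrite mxE lexx.
Qed.

(** This is the recursion [PhiE] solved for [f b]: the term [e = b] is split off, and the remaining
    sum over [b < e] is the one that [PhiE] subtracts. *)
Lemma Phi_sum (R : realType) (d : Order.disp_t) (P : porderType d)
    (B : {fset P}) (f : P -> R) (b : P) : b \in B ->
  f b = \sum_(e <- enum_fset B | (b <= e)%O) Phi B f e.
Proof.
move=> bB; rewrite (bigID (eq_op^~ b)) /=.
rewrite (eq_bigl (eq_op^~ b)); last first.
  by move=> e; case: eqP => [->|]; rewrite ?lexx ?andbF.
rewrite -big_filter filter_pred1_uniq ?fset_uniq // big_seq1 PhiE //.
rewrite [X in (_ + X)%R](eq_bigl (fun e => (b < e)%O)) ?subrK // => e.
by rewrite lt_neqAle andbC eq_sym.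
Qed.

Lemma join_matrix_congr (R : realType) (d : Order.disp_t) (P : latticeType d)
    (n : nat) (x : 'I_n -> P) (f : P -> R) (B := [fset x i | i : 'I_n]) :
  injective x -> fset_join_closed B ->
  join_matrix x f =
  (order_mx R x)^T *m diag_mx (\row_k Phi B f (x k)) *m order_mx R x.
Proof.
move=> xI hjoin; have xB k : x k \in B by apply: in_imfset.
(* Join closure keeps the join of [x i] and [x j] in [B], so [Phi_sum] applies to it. *)
apply/matrixP => i j; rewrite !mxE (@Phi_sum _ _ _ B); last exact: hjoin.
(* Injectivity of [x] lets the sum over [B] be reindexed by [k] without repetition. *)
have enumB : perm_eq (enum_fset B) [seq x k | k : 'I_n].
  apply: uniq_perm; rewrite ?fset_uniq ?map_inj_uniq -?enumT ?enum_uniq // => y.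
  apply/imfsetP/mapP => -[k _ ->]; first by exists k; rewrite ?mem_enum.
  by exists k.
rewrite (perm_big _ enumB) big_map big_enum_cond /= big_mkcond; apply: eq_bigr => k _.
(* The universal property of the join splits its indicator into the product of those of [x i <= x k]
   and [x j <= x k]. *)
rewrite mul_mx_diag !mxE leUx.
by do 2!case: (x _ <= x k)%O; rewrite ?mul1r ?mulr1 ?mul0r ?mulr0.
Qed.

Lemma quad_diag_mx (R : realType) (n : nat) (a : 'rV[R]_n) (v : 'cV[R]_n) :
  (v^T *m diag_mx a *m v) 0 0 = \sum_k a 0 k * v k 0 ^+ 2.
Proof.
rewrite mxE; apply: eq_bigr => k _.
by rewrite mul_mx_diag !mxE expr2 mulrCA mulrA.
Qed.

(** For invertible [L], the substitution [w = L *m v] permutes the nonzero vectors and turns the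
    form into a weighted sum of squares of the coordinates of [w]. *)
Lemma posdefmx_congr_diag (R : realType) (n : nat) (L : 'M[R]_n)
    (a : 'rV[R]_n) : L \in unitmx ->
  posdefmx (L^T *m diag_mx a *m L) <-> forall k, 0 < a 0 k.
Proof.
move=> Lu; have quadE (v : 'cV[R]_n) :
    (v^T *m (L^T *m diag_mx a *m L) *m v) 0 0 =
    \sum_k a 0 k * (L *m v) k 0 ^+ 2.
  by rewrite -quad_diag_mx trmx_mul !mulmxA.
split=> [[_ pos] k | a_gt0].
  (* The test vector is the preimage of a basis vector under [L]; the form takes the value [a 0 k]
     there. *)
  pose e : 'cV[R]_n := delta_mx k 0.
  have /pos : invmx L *m e != 0.
    apply/eqP => /(congr1 (mulmx L)); rewrite mulKVmx // mulmx0.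
    by move=> /matrixP/(_ k 0)/eqP; rewrite !mxE !eqxx oner_eq0.
  rewrite quadE mulKVmx // (bigD1 k) //= big1 => [|l /negPf lk].
    by rewrite !mxE !eqxx expr1n mulr1 addr0.
  by rewrite !mxE lk expr0n mulr0.
split=> [|v v0].
  (* Symmetric means hermitian with sign [(-1) ^+ 0] and the identity as conjugation. *)
  by apply/is_hermitianmxP; rewrite expr0 scale1r map_mx_id // !trmx_mul trmxK
    tr_diag_mx mulmxA.
(* One nonzero coordinate of [L *m v] makes its term strictly positive; the other terms are
   nonnegative. *)
have [k wk0] : exists k, (L *m v) k 0 != 0.
  apply/existsP; apply: contraNT v0 => /existsPn w0.
  rewrite -(mulKmx Lu v) (_ : L *m v = 0) ?mulmx0 //.
  by apply/colP => k; rewrite [RHS]mxE; apply/eqP; rewrite -[_ == _]negbK.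
rewrite quadE (bigD1 k) //= ltr_pwDl //.
  by apply: mulr_gt0; rewrite // exprn_even_gt0.
by apply: sumr_ge0 => l _; rewrite mulr_ge0 ?sqr_ge0 // ltW.
Qed.

Theorem theorem3p2 (R : realType) (d : Order.disp_t) (P : latticeType d)
    (hinf : infinite_set [set: P]%classic)
    (hfin : locally_finite P)
    (f : P -> R) (n : nat) (x : 'I_n -> P)
    (hinj : injective x)
    (hord : forall i j : 'I_n, (x i <= x j)%O -> (i <= j)%N)
    (hjoin : fset_join_closed [fset x i | i : 'I_n]) :
  posdefmx (join_matrix x f) <->
  (forall i : 'I_n, 0 < Phi [fset x i | i : 'I_n] f (x i)).
Proof.
rewrite (join_matrix_congr f hinj hjoin).
rewrite (posdefmx_congr_diag _ (order_mx_unit R hord)).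
by split=> pos i; have := pos i; rewrite mxE.
Qed.
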